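(* Let $\mathfrak{g}_0$ be a compact semisimple real Lie algebra, let $U$ be a finite dimensional real $\mathfrak{g}_0$-module, and let $\mathfrak{n}_0=U\oplus\mathfrak{g}_0$ (direct sum of real vector spaces). Let $\langle\,,\rangle_1$ and $\langle\,,\rangle_2$ be two positive definite inner products on $\mathfrak{n}_0$ that both satisfy properties 1), 2), 3) of the context, and let $[\,,]_1$ and $[\,,]_2$ be the corresponding 2-step nilpotent Lie algebra structures on $\mathfrak{n}_0$. Then the Lie algebras $\{\mathfrak{n}_0,[\,,]_1\}$ and $\{\mathfrak{n}_0,[\,,]_2\}$ are isomorphic.
   Context: A compact semisimple real Lie algebra is one whose Killing form is negative definite. The properties of a positive definite inner product $\langle\,,\rangle$ on $\mathfrak{n}_0=U\oplus\mathfrak{g}_0$ are: 1) $U$ and $\mathfrak{g}_0$ are orthogonal relative to $\langle\,,\rangle$; 2) $\langle Xu,u'\rangle+\langle u,Xu'\rangle=0$ for all $u,u'\in U$ and all $X\in\mathfrak{g}_0$; 3) $\langle \mathrm{ad}\,X(Y),Z\rangle+\langle Y,\mathrm{ad}\,X(Z)\rangle=0$ for all $X,Y,Z\in\mathfrak{g}_0$ (here $\mathrm{ad}$ is the adjoint representation of the semisimple Lie algebra $\mathfrak{g}_0$). The corresponding Lie algebra structure $[\,,]$ on $\mathfrak{n}_0$ is the real Lie algebra structure for which $\mathfrak{g}_0$ lies in the center of $\mathfrak{n}_0$, $[\mathfrak{n}_0,\mathfrak{n}_0]\subseteq\mathfrak{g}_0$, and $\langle[u,u'],Z\rangle=\langle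 Z(u),u'\rangle$ for all $u,u'\in U$ and all $Z\in\mathfrak{g}_0$. *)

(* Defs.v *)
From HB Require Import structures.
From mathcomp Require Import all_boot all_order all_algebra.
From mathcomp Require Import sesquilinear reals.

Set Implicit Arguments.
Unset Strict Implicit.
Unset Printing Implicit Defensive.

Import Order.TTheory GRing.Theory Num.Theory.

Local Open Scope ring_scope.

(* A Lie algebra is given by a module V together with an element of
   [lieBracket V], so that one V can carry several Lie algebra structures. *)
HB.mixin Record isLieBracket (R : nzRingType) (V : lmodType R)
    (br : V -> V -> V) := {
  lie_alt : forall x, br x x = 0 ;
  lie_jacobi : forall x y z,
    br x (br y z) + br y (br z x) + br z (br x y) = 0
}.

#[short(type="lieBracket")]
HB.structure Definition LieBracket (R : nzRingType) (V : lmodType R) :=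
  {br of @Bilinear R V V V *:%R *:%R br & @isLieBracket R V br}.

Definition lie_isomorphic (R : nzRingType) (V W : lmodType R)
    (brV : lieBracket V) (brW : lieBracket W) : Prop :=
  exists f : {linear V -> W},
    bijective f /\ (forall x y, f (brV x y) = brW (f x) (f y)).

(* The trace does not depend on the choice of the basis [vbasis fullv]. *)
Definition endo_trace (F : fieldType) (V : vectType F) (h : 'End(V)) : F :=
  \tr (passmx.mxof (vbasis {:V}) (vbasis {:V}) h).

Definition killing (F : fieldType) (g : vectType F) (br : lieBracket g)
    (x y : g) : F :=
  endo_trace (linfun (br x) \o linfun (br y))%VF.

Definition compact_semisimple (R : realType) (g : vectType R)
    (br : lieBracket g) : Prop :=
  forall x, x != 0 -> killing br x x < 0.

Definition lie_module (R : nzRingType) (g U : lmodType R) (br : lieBracket g)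
    (act : {bilinear g -> U -> U}) : Prop :=
  forall X Y u, act (br X Y) u = act X (act Y u) - act Y (act X u).

(* The direct sum of U and g is the product type U * g: the summand U is the
   set of pairs (u, 0), and the summand g is the set of pairs (0, X). *)
Section Nilpotent.
Variables (R : realType) (g U : vectType R).
Implicit Types dot : {dot (U * g)%type for idfun}.

Definition admissible (br : lieBracket g) (act : {bilinear g -> U -> U}) dot
    : Prop :=
  [/\ forall u X, dot (u, 0) (0, X) = 0,
      forall X u u', dot (act X u, 0) (u', 0) + dot (u, 0) (act X u', 0) = 0
    & forall X Y Z, dot (0, br X Y) (0, Z) + dot (0, Y) (0, br X Z) = 0].

Definition corresponding_bracket (act : {bilinear g -> U -> U}) dot
    (nbr : lieBracket (U * g)%type) : Prop :=
  [/\ forall X v, nbr (0, X) v = 0,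
      forall v w, (nbr v w).1 = 0
    & forall u u' Z, dot (nbr (u, 0) (u', 0)) (0, Z) = dot (act Z u, 0) (u', 0)].

End Nilpotent.

(* Main.v *)
Require Import Defs.
From HB Require Import structures.
From mathcomp Require Import all_boot all_order all_algebra.
From mathcomp Require Import sesquilinear reals.
From mathcomp Require Import complex ring.

(** Write b1 and b2 for the restrictions of the two inner products to U.  There
    is an operator S on U with b1 (u, v) = b2 (S u, v), it is self-adjoint and
    positive for b2, and it commutes with the Lie algebra because both forms
    are invariant.  It has a square root T that is a polynomial in S, so T also
    commutes with the action and satisfies b1 (u, v) = b2 (T u, T v).  In the
    same way there is an operator Q on the Lie algebra summand, self-adjoint
    for the second inner product, such that Z |-> Q (Q Z) represents the first
    inner product there relative to the second.  Then, for every Z,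
      <Q (Q [u, u']_1), Z>_2 = <[u, u']_1, Z>_1 = <Z u, u'>_1
        = <T (Z u), T u'>_2 = <Z (T u), T u'>_2 = <[T u, T u']_2, Z>_2,
    so that the bijection (u, Z) |-> (T u, Q (Q Z)) is a morphism of Lie
    algebras.

    The square root is the only substantial point ([equivariant_sqrt]).  In
    coordinates S is the matrix A = G1 G2^-1, where G1 and G2 are the Gram
    matrices.  The complex roots of its characteristic polynomial are quotients
    of values of positive Hermitian forms, hence positive reals
    ([char_poly_self_adjoint]).  For a product p of linear factors with
    positive roots, repeated or not, 'X is a square modulo p
    ([polyX_square_mod_prod]).  If q ^ 2 = 'X modulo the characteristic
    polynomial, the Cayley-Hamilton theorem makes q(A) a square root of A; this
    avoids diagonalizing A. *)

Set Implicit Arguments.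
Unset Strict Implicit.
Unset Printing Implicit Defensive.

Import Order.TTheory GRing.Theory Num.Theory passmx.

Local Open Scope ring_scope.

(** * Square roots modulo split polynomials *)

(** Newton-Hensel lifting, one linear factor at a time: if q is a square root of
    'X modulo p, then so is q + c p, and the scalar c can be chosen to gain the
    factor 'X - r.  Allowing repeated roots means that a matrix need not be
    known to be diagonalizable before this is applied to it. *)
Lemma polyX_square_mod_prod (R : rcfType) (rs : seq R) :
  all (fun r => 0 < r) rs ->
  exists q : {poly R}, \prod_(r <- rs) ('X - r%:P) %| q ^+ 2 - 'X.
Proof.
elim: rs => [|r rs IHrs] /=; first by exists 0; rewrite big_nil dvd1p.
case/andP=> r_gt0 /IHrs[q]; rewrite big_cons; set p := \prod_(_ <- _) _.
move=> /dvdpP[h def_h].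
(* h + 2 c q + c^2 p is the cofactor of p in (q + c p)^2 - 'X. *)
suff [c def_c] : exists c, h.[r] + c * q.[r] *+ 2 + c ^+ 2 * p.[r] = 0.
  exists (q + c%:P * p).
  have -> : (q + c%:P * p) ^+ 2 - 'X
          = (h + c%:P * q *+ 2 + c%:P ^+ 2 * p) * p.
    by rewrite !mulrDl -def_h; ring.
  apply: dvdp_mul => //.
  rewrite dvdp_XsubCl rootE -[X in _ == X]def_c.
  by apply/eqP; rewrite !hornerE; ring.
have h_r : h.[r] * p.[r] = q.[r] ^+ 2 - r.
  by have := congr1 (horner^~ r) def_h; rewrite !hornerE => <-.
(* If r is not yet a root of p, c is chosen to give q + c p the value sqrt r at
   r; if it is, the equation is affine in c with slope 2 q(r), and
   q(r)^2 = r is nonzero. *)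
have [pr0 | pr_n0] := eqVneq p.[r] 0; last first.
  exists ((Num.sqrt r - q.[r]) / p.[r]).
  have sr : Num.sqrt r ^+ 2 = r by rewrite sqr_sqrtr // ltW.
  have -> : h.[r] = (q.[r] ^+ 2 - Num.sqrt r ^+ 2) / p.[r].
    by rewrite sr -h_r mulfK.
  by field.
have qr_n0 : q.[r] != 0.
  apply: contraTneq r_gt0 => q0; move: h_r.
  rewrite pr0 q0 mulr0 expr0n /= sub0r => /esym/eqP.
  by rewrite oppr_eq0 => /eqP->; rewrite ltxx.
exists (- h.[r] / (2%:R * q.[r])); rewrite pr0.
by field.
Qed.

(** * Positive definite matrices *)

Definition posdefmx (R : realFieldType) n (G : 'M[R]_n) : Prop :=
  G^T = G /\ forall u : 'rV_n, u != 0 -> 0 < (u *m G *m u^T) 0 0.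

Lemma posdefmx_unit (R : realFieldType) n (G : 'M[R]_n) :
  posdefmx G -> G \in unitmx.
Proof.
case=> _ Gpos; rewrite -row_free_unit -kermx_eq0.
apply/rowV0P => u /sub_kermxP uG0.
by apply/eqP; apply: contraT => /Gpos; rewrite uG0 mul0mx mxE ltxx.
Qed.

Local Open Scope complex_scope.

(** For v = x + i y the imaginary parts cancel by symmetry of G, and the value
    is the sum of those of G at x and at y. *)
Lemma posdefmx_complex (R : rcfType) n (G : 'M[R]_n) (v : 'rV[R[i]]_n) :
  posdefmx G -> v != 0 ->
  0 < (v *m map_mx (real_complex R) G *m (map_mx conjc v)^T) 0 0.
Proof.
case=> symG Gpos v_n0.
pose x := map_mx (@complex.Re R) v; pose y := map_mx (@complex.Im R) v.
have def_v : v = map_mx (real_complex R) x + 'i *: map_mx (real_complex R) y.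
  by apply/rowP=> j; rewrite !mxE -complexE.
have def_w : map_mx conjc v
    = map_mx (real_complex R) x - 'i *: map_mx (real_complex R) y.
  apply/rowP=> j; rewrite !mxE; case: (v 0 j) => a b /=.
  by apply/eqP; rewrite eq_complex /=; simpc.
move: x y def_v def_w => x y def_v def_w.
have Gxy : (x *m G *m y^T) 0 0 = (y *m G *m x^T) 0 0.
  by rewrite -[in LHS](trmxK (x *m G *m y^T)) mxE !trmx_mul trmxK symG mulmxA.
have Gge0 (u : 'rV_n) : 0 <= (u *m G *m u^T) 0 0.
  have [->|u_n0] := eqVneq u 0; first by rewrite !mul0mx mxE.
  exact/ltW/Gpos.
have -> : (v *m map_mx (real_complex R) G *m (map_mx conjc v)^T) 0 0
    = ((x *m G *m x^T) 0 0 + (y *m G *m y^T) 0 0)%:C.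
  rewrite def_w {1}def_v linearB /= linearZ /= !map_trmx.
  rewrite !mulmxDl !mulmxDr !mulmxN -!scalemxAl -!scalemxAr -!map_mxM.
  move: Gxy; move: (x *m _ *m x^T) (x *m _ *m y^T) (y *m _ *m x^T).
  move: (y *m _ *m y^T) => b d c c' Gxy; rewrite !mxE Gxy rmorphD /= mulrA.
  by rewrite -expr2 sqr_i; ring.
rewrite ltcR.
have [x0 | x_n0] := eqVneq x 0; last by rewrite ltr_wpDr ?Gpos.
rewrite ltr_wpDl ?Gpos //; apply: contraNneq v_n0 => y0.
by rewrite def_v x0 y0 !map_mx0 scaler0 addr0.
Qed.

(** If v is an eigenvector of G1 G2^-1 for z, then v G1 v^* = z v G2 v^*, so z
    is a quotient of two positive numbers. *)
Lemma self_adjoint_root_gt0 (R : rcfType) n (G1 G2 : 'M[R]_n) (z : R[i]) :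
  posdefmx G1 -> posdefmx G2 ->
  root (map_poly (real_complex R) (char_poly (G1 *m invmx G2))) z ->
  exists2 r : R, 0 < r & z = r%:C.
Proof.
move=> G1pos G2pos; rewrite map_char_poly -eigenvalue_root_char.
case/eigenvalueP=> v def_zv v_n0.
have G1v := posdefmx_complex G1pos v_n0.
have G2v := posdefmx_complex G2pos v_n0.
move: (G1v).
rewrite -[G1 in map_mx _ G1](mulmxKV (posdefmx_unit G2pos)) map_mxM.
rewrite [v *m _]mulmxA def_zv -!scalemxAl mxE pmulr_lgt0 // => z_gt0.
have /complex_realP[r def_z] : z \is Num.real by rewrite gtr0_real.
by exists r; move: z_gt0; rewrite // def_z ltcR.
Qed.

Lemma char_poly_self_adjoint (R : rcfType) n (G1 G2 : 'M[R]_n) :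
  posdefmx G1 -> posdefmx G2 ->
  exists2 rs : seq R, all (fun r => 0 < r) rs
    & char_poly (G1 *m invmx G2) = \prod_(r <- rs) ('X - r%:P).
Proof.
move=> G1pos G2pos; set p := char_poly _.
have [zs] := closed_field_poly_normal (map_poly (real_complex R) p).
have /monicP-> : map_poly (real_complex R) p \is monic.
  by rewrite map_monic char_poly_monic.
rewrite scale1r => def_p.
have [rs rs_gt0 def_zs] : exists2 rs : seq R, all (fun r => 0 < r) rs
    & zs = map (real_complex R) rs.
  have: all (root (map_poly (real_complex R) p)) zs.
    by apply/allP=> z z_zs; rewrite def_p root_prod_XsubC.
  elim: zs {def_p} => [|z zs IHzs] /=; first by exists [::].
  case/andP=> /(self_adjoint_root_gt0 G1pos G2pos)[r r_gt0 ->].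
  by case/IHzs=> rs rs_gt0 ->; exists (r :: rs); rewrite //= r_gt0.
exists rs => //; apply: (map_poly_inj (real_complex R)).
rewrite def_p def_zs big_map rmorph_prod /=; apply: eq_bigr => r _.
by rewrite rmorphB /= map_polyX map_polyC.
Qed.

Local Close Scope complex_scope.

(** Vectors are rows, so T is self-adjoint for G2 when T G2 = G2 T^T, and M is
    skew for G when M G + G M^T = 0.  A matrix that is skew for both forms
    commutes with A = G1 G2^-1, hence with T, a polynomial in A.  As A is
    self-adjoint for G2, so is T, whence T G2 T^T = T T G2 = A G2 = G1. *)
Lemma mx_self_adjoint_sqrt (R : rcfType) n (G1 G2 : 'M[R]_n) :
    posdefmx G1 -> posdefmx G2 ->
  exists T : 'M[R]_n,
    [/\ T *m G2 = G2 *m T^T, T *m G2 *m T^T = G1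
      & forall M : 'M[R]_n, M *m G1 + G1 *m M^T = 0 ->
          M *m G2 + G2 *m M^T = 0 -> M *m T = T *m M].
Proof.
(* Evaluation of polynomials at matrices requires a nonzero size. *)
case: n G1 G2 => [|n] G1 G2 G1pos G2pos.
  by exists 0; split=> [||M _ _]; apply/matrixP; case.
have [symG1 _] := G1pos; have [symG2 _] := G2pos.
have G2u := posdefmx_unit G2pos.
pose A := G1 *m invmx G2.
have [rs /polyX_square_mod_prod[q]] := char_poly_self_adjoint G1pos G2pos.
rewrite -/A => dvd_q def_p; rewrite -def_p in dvd_q.
have A_adj : A *m G2 = G2 *m A^T.
  by rewrite mulmxKV // trmx_mul trmx_inv symG1 symG2 mulKVmx.
pose T := horner_mx A q.
have T_adj : T *m G2 = G2 *m T^T.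
  rewrite /T; elim/poly_ind: q {dvd_q T} => [|q c IHq].
    by rewrite rmorph0 mul0mx trmx0 mulmx0.
  rewrite rmorphD rmorphM /= horner_mx_X horner_mx_C.
  rewrite mulmxDl -mulmxA A_adj mulmxA IHq linearD /= mulmxDr tr_scalar_mx.
  rewrite -mulmxA scalar_mxC; congr (_ *m _ + _).
  rewrite -trmx_mul; congr _^T.
  by have := comm_horner_mx2 A 'X q; rewrite horner_mx_X.
have TT : T *m T = A.
  apply/eqP; rewrite -subr_eq0.
  have -> : T *m T - A = horner_mx A (q ^+ 2 - 'X).
    by rewrite rmorphB rmorphXn /= horner_mx_X.
  by case/dvdpP: dvd_q => h ->; rewrite rmorphM /= Cayley_Hamilton mulr0.
exists T; split=> // [|M skew1 skew2].
  by rewrite -mulmxA -T_adj mulmxA TT mulmxKV.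
apply: comm_mx_horner; rewrite /comm_mx /A.
move/eqP: skew1; rewrite addr_eq0 => /eqP skew1.
move/eqP: skew2; rewrite addr_eq0 => /eqP skew2.
apply: (can_inj (mulmxK G2u)).
rewrite mulmxA mulmxKV // -!mulmxA skew2 skew1.
by rewrite mulmxN mulKmx // mulmxN.
Qed.

(** * Inner products on vector spaces *)

(** Stated for plain functions, so that the restriction of an inner product to a
    summand qualifies without being given a bundled structure; linearity in the
    second argument follows by symmetry. *)
Definition inner_product (R : numDomainType) (V : lmodType R)
    (b : V -> V -> R) : Prop :=
  [/\ forall w, scalar (b^~ w), forall u v, b u v = b v u
    & forall u, u != 0 -> 0 < b u u].

Lemma inner_product_inj (R : numDomainType) (V : lmodType R) (b : V -> V -> R)
    (x y : V) :
  inner_product b -> (forall v, b x v = b y v) -> x = y.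
Proof.
case=> lin_b _ pos_b eq_xy; apply/eqP; rewrite -subr_eq0.
apply: contraT => /pos_b.
by rewrite -[X in b X _]addrC -scaleN1r lin_b eq_xy mulN1r addNr ltxx.
Qed.

Section GramMatrix.
Variables (R : realFieldType) (V : vectType R) (b : V -> V -> R).
Hypothesis b_inner : inner_product b.
Let e := vbasis {:V}.
Let e_basis : basis_of {:V} e := vbasisP {:V}.

Definition gram : 'M[R]_(\dim {:V}) := \matrix_(i, j) b e`_i e`_j.

Lemma gramE u v : b u v = (rVof e u *m gram *m (rVof e v)^T) 0 0.
Proof.
case: b_inner => lin_b sym_b _.
have b_suml w c : b (vecof e c) w = \sum_i c 0 i * b e`_i w.
  have b0 : b 0 w = 0.
    by have := lin_b w (-1) 0 0; rewrite scaler0 addr0 mulN1r addNr.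
  rewrite (big_morph (b^~ w) (id1 := 0) (op1 := +%R)) //; last first.
    by move=> x y; rewrite -{1}[x]scale1r lin_b mul1r.
  by apply: eq_bigr => i _; rewrite -[_ *: _]addr0 lin_b b0 addr0.
rewrite -{1}(rVofK e_basis u) b_suml -mulmxA mxE; apply: eq_bigr => i _.
congr (_ * _); rewrite sym_b -{1}(rVofK e_basis v) b_suml mxE.
by apply: eq_bigr => j _; rewrite !mxE mulrC sym_b.
Qed.

Lemma gram_posdef : posdefmx gram.
Proof.
case: b_inner => _ sym_b pos_b; split.
  by apply/matrixP=> i j; rewrite !mxE sym_b.
move=> u; rewrite -(vecof_eq0 e_basis) => /pos_b.
by rewrite gramE (vecofK e_basis).
Qed.

End GramMatrix.

Lemma eq_mx_form (R : comNzRingType) n (M N : 'M[R]_n) :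
  (forall u v : 'rV_n, (u *m M *m v^T) 0 0 = (u *m N *m v^T) 0 0) -> M = N.
Proof.
move=> eqMN; apply/matrixP=> i j.
have := eqMN (delta_mx 0 i) (delta_mx 0 j).
by rewrite -!rowE !trmx_delta -!colE !mxE.
Qed.

(** A square root of the operator that represents b1 relative to b2.  It is
    used twice: on the module for its equivariance, and on the Lie algebra,
    where T (T u) is the operator representing b1, available with its
    bijectivity. *)
Lemma equivariant_sqrt (R : rcfType) (V : vectType R) (b1 b2 : V -> V -> R) :
    inner_product b1 -> inner_product b2 ->
  exists T : 'End(V),
    [/\ bijective T,
        forall u v, b2 (T u) v = b2 u (T v),
        forall u v, b2 (T u) (T v) = b1 u v
      & forall M : 'End(V),
          (forall u v, b1 (M u) v + b1 u (M v) = 0) ->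
          (forall u v, b2 (M u) v + b2 u (M v) = 0) ->
        forall u, T (M u) = M (T u)].
Proof.
move=> b1_inner b2_inner.
have e_basis := vbasisP {:V}; set e := vbasis {:V} in e_basis.
have [T [T_adj T_isom T_comm]] :=
  mx_self_adjoint_sqrt (gram_posdef b1_inner) (gram_posdef b2_inner).
pose tau := hommx e e T.
have tauE u : rVof e (tau u) = rVof e u *m T by rewrite -rVof_mul.
have isom u v : b2 (tau u) (tau v) = b1 u v.
  by rewrite (gramE b2_inner) (gramE b1_inner) !tauE trmx_mul -T_isom !mulmxA.
exists tau; split=> // [|u v|M skew1 skew2 u].
- have ker0 : lker tau == 0%VS.
    apply/lker0P=> u v eq_uv; apply: (inner_product_inj b1_inner) => w.
    by rewrite -!isom eq_uv.
  by exists (tau^-1)%VF; [apply: lker0_lfunK | apply: lker0_lfunVK].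
- rewrite !(gramE b2_inner) !tauE trmx_mul -!mulmxA; congr ((_ *m _) 0 0).
  by rewrite !mulmxA T_adj.
apply: (can_inj (rVofK e_basis)).
rewrite tauE (rVof_app e e_basis M u) (rVof_app e e_basis M (tau u)) tauE.
have skew_mx b : inner_product b ->
    (forall u v, b (M u) v + b u (M v) = 0) ->
    mxof e e M *m gram b + gram b *m (mxof e e M)^T = 0.
  move=> b_inner skew; apply: eq_mx_form => x y.
  have := skew (vecof e x) (vecof e y).
  rewrite !(gramE b_inner) !(rVof_app e e_basis) !(vecofK e_basis) => skew_xy.
  rewrite mulmx0 mul0mx [RHS]mxE -[RHS]skew_xy.
  by rewrite mulmxDr mulmxDl trmx_mul !mulmxA [LHS]mxE.
by rewrite -!mulmxA T_comm //; apply: skew_mx.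
Qed.

Lemma inner_product_pullback (R : numDomainType) (V W : lmodType R)
    (dot : {dot W for idfun}) (f : V -> W) :
  linear f -> injective f -> inner_product (fun u v => dot (f u) (f v)).
Proof.
move=> lin_f inj_f; split=> [w a u v|u v|u u_n0].
- by rewrite lin_f linearPl.
- by rewrite hermC /= expr0 mul1r.
apply: neq0_dnorm_gt0.
have f0 : f 0 = 0.
  by have := lin_f (-1) 0 0; rewrite scaler0 addr0 scaleN1r addNr.
by rewrite -f0 (inj_eq inj_f).
Qed.

(** * The isomorphism *)

Definition prod_map (R : nzRingType) (U U' W W' : lmodType R)
    (f : {linear U -> U'}) (h : {linear W -> W'}) (x : U * W) : U' * W' :=
  (f x.1, h x.2).

Lemma prod_map_linear (R : nzRingType) (U U' W W' : lmodType R)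
    (f : {linear U -> U'}) (h : {linear W -> W'}) : linear (prod_map f h).
Proof. by move=> a x y; rewrite /prod_map /= !linearP. Qed.

HB.instance Definition _ (R : nzRingType) (U U' W W' : lmodType R)
    (f : {linear U -> U'}) (h : {linear W -> W'}) :=
  GRing.isSemilinear.Build R _ _ _ (prod_map f h)
    (GRing.semilinear_linear (prod_map_linear f h)).

Lemma prod_map_bij (R : nzRingType) (U U' W W' : lmodType R)
    (f : {linear U -> U'}) (h : {linear W -> W'}) :
  bijective f -> bijective h -> bijective (prod_map f h).
Proof.
case=> f' fK f'K [h' hK h'K].
exists (fun y => (f' y.1, h' y.2)) => -[u w]; first by rewrite /= fK hK.
by rewrite /prod_map /= f'K h'K.
Qed.

Lemma lie_anti (R : nzRingType) (V : lmodType R) (br : lieBracket V) (x y : V) :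
  br x y = - br y x.
Proof.
apply/eqP; rewrite -addr_eq0.
have := lie_alt (s := br) (x + y).
by rewrite linearDl !linearDr /= !lie_alt add0r addr0 => ->.
Qed.

Theorem proposition2p4 (R : realType) (g U : vectType R)
    (br : lieBracket g) (hcs : compact_semisimple br)
    (act : {bilinear g -> U -> U}) (hact : lie_module br act)
    (dot1 dot2 : {dot (U * g)%type for idfun})
    (hdot1 : admissible br act dot1) (hdot2 : admissible br act dot2)
    (br1 br2 : lieBracket (U * g)%type)
    (hbr1 : corresponding_bracket act dot1 br1)
    (hbr2 : corresponding_bracket act dot2 br2) :
  lie_isomorphic br1 br2.
Proof.
pose onU (dot : {dot (U * g)%type for idfun}) (u u' : U) := dot (u, 0) (u', 0).
pose ong (dot : {dot (U * g)%type for idfun}) (Z Z' : g) := dot (0, Z) (0, Z').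
have onU_inner dot : inner_product (onU dot).
  apply: inner_product_pullback => [a u v|u v [] //].
  by apply/eqP; rewrite xpair_eqE /= scaler0 addr0 !eqxx.
have ong_inner dot : inner_product (ong dot).
  apply: inner_product_pullback => [a u v|u v [] //].
  by apply/eqP; rewrite xpair_eqE /= scaler0 addr0 !eqxx.
have [T [T_bij _ T_isom T_comm]] :=
  equivariant_sqrt (onU_inner dot1) (onU_inner dot2).
have [Q [Q_bij Q_adj Q_isom _]] :=
  equivariant_sqrt (ong_inner dot1) (ong_inner dot2).
have [_ act_skew1 _] := hdot1; have [_ act_skew2 _] := hdot2.
have actT Z u : T (act Z u) = act Z (T u).
  have := T_comm (linfun (act Z)); rewrite /onU => /(_ _ _ u).
  rewrite !lfunE; apply=> v w; rewrite !lfunE.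
  - exact: act_skew1.
  - exact: act_skew2.
have [cent1 in_g1 def1] := hbr1; have [cent2 in_g2 def2] := hbr2.
have brE (nbr : lieBracket (U * g)%type) : (forall X v, nbr (0, X) v = 0) ->
    forall u X u' X', nbr (u, X) (u', X') = nbr (u, 0) (u', 0).
  move=> cent u X u' X'.
  have split_pair (a : U) (Y : g) : (a, Y) = (a, 0) + (0, Y).
    by apply/eqP; rewrite xpair_eqE /= addr0 add0r !eqxx.
  rewrite (split_pair u) (split_pair u') linearDl /= cent addr0 linearDr /=.
  by rewrite [X in _ + X]lie_anti cent oppr0 addr0.
exists (prod_map T (Q \o Q)%VF); split.
  apply: prod_map_bij => //.
  by apply: (eq_bij (bij_comp Q_bij Q_bij)) => Z /=; rewrite lfunE.
move=> [u X] [u' X']; rewrite [in RHS]/prod_map /= (brE _ cent1) (brE _ cent2).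
have := in_g1 (u, 0) (u', 0); have := in_g2 (T u, 0) (T u', 0).
case E1: (br1 _ _) => [w1 Z1]; case E2: (br2 _ _) => [w2 Z2] /= w20 w10.
rewrite w10 in E1; rewrite w20 in E2.
rewrite w10 w20 /prod_map /= linear0; congr (_, _).
apply: (inner_product_inj (ong_inner dot2)) => Z.
rewrite lfunE /= Q_adj Q_isom /ong -E1 -E2 def1 def2 -actT.
exact/esym/T_isom.
Qed.
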